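(* Let $a \ge 2$ and $k \ge 1$ be integers. Then $$\frac{1}{a^k}\int_{(0,1)^k} \frac{(x_1\cdots x_k)^{-1+1/a} + (x_1\cdots x_k)^{-1/a}}{1-(-1)^k x_1\cdots x_k}\,dx_1\cdots dx_k \;=\; S(k,a), \qquad S(k,a):=\sum_{n\in\mathbb{Z}} \frac{(-1)^{nk}}{(an+1)^k}.$$
   Context: The sum over $\mathbb{Z}$ is understood as $\sum_{n\ge 0}\frac{(-1)^{nk}}{(an+1)^k}+\sum_{n\le -1}\frac{(-1)^{nk}}{(an+1)^k}$, each one-sided series being summed in order of increasing $|n|$ (for $k\ge2$ the series converges absolutely; for $k=1$ each one-sided series converges conditionally). *)

(* Defs.v *)
From HB Require Import structures.
From mathcomp Require Import all_boot all_order all_algebra.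
From mathcomp Require Import all_classical all_reals all_analysis.

Set Implicit Arguments.
Unset Strict Implicit.
Unset Printing Implicit Defensive.

Import Order.TTheory GRing.Theory Num.Theory.
Import numFieldNormedType.Exports.

Local Open Scope classical_set_scope.
Local Open Scope ring_scope.

Section tuple_cons_measure.
Local Open Scope ereal_scope.
Context d (T : measurableType d) (R : realType) (n : nat).
Variables (m1 : {sigma_finite_measure set T -> \bar R})
          (m2 : {sigma_finite_measure set (n.-tuple T) -> \bar R}).

Definition tuple_cons (p : T * n.-tuple T) : n.+1.-tuple T :=
  [tuple of p.1 :: p.2].

Definition tuple_uncons (x : n.+1.-tuple T) : T * n.-tuple T :=
  (tnth x ord0, [tuple of behead x]).

Lemma tuple_consK : cancel tuple_cons tuple_uncons.
Proof.
by move=> [t x]; rewrite /tuple_uncons /tuple_cons/=; congr pair; exact/val_inj.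
Qed.

Lemma tuple_unconsK : cancel tuple_uncons tuple_cons.
Proof. by move=> x; rewrite [RHS]tuple_eta; exact/val_inj. Qed.

Lemma measurable_tuple_cons : measurable_fun [set: T * n.-tuple T] tuple_cons.
Proof. exact: measurable_cons. Qed.

Lemma measurable_tuple_uncons :
  measurable_fun [set: n.+1.-tuple T] tuple_uncons.
Proof.
by apply/measurable_fun_pair; [exact: measurable_tnth|exact: measurable_behead].
Qed.

Definition tuple_cons_measure : set (n.+1.-tuple T) -> \bar R :=
  pushforward (m1 \x m2) tuple_cons.

Let tcm0 : tuple_cons_measure set0 = 0.
Proof. by rewrite /tuple_cons_measure /pushforward preimage_set0 measure0. Qed.

Let tcm_ge0 A : 0 <= tuple_cons_measure A.
Proof. exact: integral_ge0. Qed.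

Let tcm_sigma_additive : semi_sigma_additive tuple_cons_measure.
Proof.
have := @measure_semi_sigma_additive _ _ _ (pushforward (m1 \x m2) tuple_cons).
by apply; exact: measurable_tuple_cons.
Qed.

HB.instance Definition _ := isMeasure.Build _ _ _
  tuple_cons_measure tcm0 tcm_ge0 tcm_sigma_additive.

Lemma tuple_cons_measureX (A : set T) (B : set (n.-tuple T)) :
  measurable A -> measurable B ->
  tuple_cons_measure (tuple_uncons @^-1` (A `*` B)) = m1 A * m2 B.
Proof.
move=> mA mB; rewrite -product_measure1E//.
rewrite /tuple_cons_measure /pushforward -comp_preimage.
rewrite (_ : tuple_uncons \o tuple_cons = id) ?preimage_id//.
by apply/funext => p /=; rewrite tuple_consK.
Qed.

(* Proved directly: the sigma-finiteness instance that the library infers for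
   [\x] only applies to subprobabilities. *)
Let tcm_sigma_finite : sigma_finite setT tuple_cons_measure.
Proof.
have /sigma_finiteP[F [TF ndF Foo]] := sigma_finiteT m1.
have /sigma_finiteP[G [TG ndG Goo]] := sigma_finiteT m2.
exists (fun i => tuple_uncons @^-1` (F i `*` G i)).
  rewrite -preimage_bigcup (_ : \bigcup_i _ = setT) ?preimage_setT//.
  apply/seteqP; split => // -[x y] _.
  have [i _ Fx] : (\bigcup_i F i) x by rewrite -TF.
  have [j _ Gy] : (\bigcup_i G i) y by rewrite -TG.
  exists (maxn i j) => //; split => /=.
  - by move: x Fx; exact/subsetPset/ndF/leq_maxl.
  - by move: y Gy; exact/subsetPset/ndG/leq_maxr.
move=> i; have [mF Fioo] := Foo i; have [mG Gioo] := Goo i; split.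
  rewrite -[X in measurable X]setTI.
  by apply: measurable_tuple_uncons => //; exact: measurableX.
by rewrite tuple_cons_measureX// lte_mul_pinfty// ge0_fin_numE.
Qed.

HB.instance Definition _ := Measure_isSigmaFinite.Build _ _ _
  tuple_cons_measure tcm_sigma_finite.

End tuple_cons_measure.

(* k-dimensional Lebesgue measure on R^k, as an iterated product of the
   one-dimensional one; R^0 is a point of mass 1. *)
Fixpoint lebesgue_measure_tuple (R : realType) (k : nat) :
    {sigma_finite_measure set (k.-tuple (measurableTypeR R)) -> \bar R} :=
  match k with
  | 0 => \d_([tuple] : 0.-tuple (measurableTypeR R))
  | n.+1 => tuple_cons_measure (@lebesgue_measure R)
              (lebesgue_measure_tuple R n)
  end.

Lemma lebesgue_measure_tuple_box (R : realType) (k : nat)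
    (A : 'I_k -> set (measurableTypeR R)) :
  (forall i, measurable (A i)) ->
  lebesgue_measure_tuple R k [set x | forall i, A i (tnth x i)] =
  (\prod_(i < k) lebesgue_measure (A i))%E.
Proof.
elim: k A => [|n IH] A mA.
  by rewrite big_ord0 /= diracE mem_set// => -[].
rewrite big_ord_recl /= /tuple_cons_measure /pushforward.
rewrite (_ : _ @^-1` _ = A ord0 `*`
    [set x : n.-tuple (measurableTypeR R) |
      forall i, A (lift ord0 i) (tnth x i)]); last first.
  apply/seteqP; split => [[t x]/= H|[t x]/= [At Ax] i].
    split; first exact: (H ord0).
    by move=> i; have := H (lift ord0 i); rewrite tnthS.
  by have [j ->|->//] := unliftP ord0 i; rewrite tnthS.
rewrite product_measure1E//; first by rewrite -IH.
rewrite (_ : [set _ | _] = \bigcap_(i in [set: 'I_n])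
    ((fun x : n.-tuple (measurableTypeR R) => tnth x i) @^-1` A (lift ord0 i))).
  apply: fin_bigcap_measurable => // i _.
  by rewrite -[X in measurable X]setTI; exact: measurable_tnth.
by apply/seteqP; split => x /= H i; [move=> _|]; exact: H.
Qed.

Definition open_cube (R : realType) (k : nat) :
    set (k.-tuple (measurableTypeR R)) :=
  [set x | forall i : 'I_k, 0 < (tnth x i : R) < 1].

Definition coord_prod (R : realType) (k : nat)
    (x : k.-tuple (measurableTypeR R)) : R :=
  \prod_(i < k) (tnth x i : R).

Definition integrand (R : realType) (k a : nat)
    (x : k.-tuple (measurableTypeR R)) : R :=
  (coord_prod x `^ (- 1 + a%:R^-1) + coord_prod x `^ (- a%:R^-1))
  / (1 - (-1) ^+ k * coord_prod x).

Definition S_term (R : realType) (k a : nat) (n : int) : R :=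
  (-1) ^ (n * k%:Z) / ((a%:Z * n + 1)%:~R ^+ k).

(* A sum over Z converges when both one-sided series do, each taken in order
   of increasing |n|; [sumZ] is a meaningful value only in that case. *)
Definition cvg_sumZ (R : realType) (u : int -> R) : Prop :=
  cvgn (series (fun n : nat => u n%:Z)) /\
  cvgn (series (fun n : nat => u (- n.+1%:Z))).

Definition sumZ (R : realType) (u : int -> R) : R :=
  limn (series (fun n : nat => u n%:Z)) +
  limn (series (fun n : nat => u (- n.+1%:Z))).

Definition bilateral_S (R : realType) (k a : nat) : R := sumZ (@S_term R k a).

(* Main.v *)
Require Import Defs.
From HB Require Import structures.
From mathcomp Require Import all_boot all_order all_algebra.
From mathcomp Require Import all_classical all_reals all_analysis.
From mathcomp Require Import measurable_realfun ring lra.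

Import Order.TTheory GRing.Theory Num.Theory.
Import numFieldNormedType.Exports.

Local Open Scope classical_set_scope.
Local Open Scope ring_scope.

(* Write p = x_1 ... x_k and e = (-1)^k. By Tonelli, p^(t-1+n) integrates over
   the cube to (n+t)^-k for t > 0, so expanding 1 / (1 - e p) in powers of e p
   turns the integral of p^(t-1) / (1 - e p) into the sum over n of
   e^n / (n+t)^k. Taking t = 1/a gives the terms of S(k,a) with n >= 0, and
   t = 1 - 1/a those with n < 0. The interchange of sum and integral is monotone
   convergence for k even. For k odd, k = 1 included, the partial sums
   p^(t-1) (1 - (-p)^n) / (1 + p) are dominated by 2 p^(t-1), which is
   integrable, and the same limit yields the convergence of the series. *)

(** * One-dimensional integral of a power *)

(** For [t < 1] the integrand is singular at 0, so the fundamental theorem of calculus is applied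
    away from 0, and monotone convergence along the increasing intervals [F n] gives the improper
    integral. *)
Lemma integral_oo01_powR (R : realType) (t : R) : 0 < t ->
  (\int[lebesgue_measure]_(x in `]0%R, 1%R[) (x `^ (t - 1))%:E = (t^-1)%:E)%E.
Proof.
move=> t0.
have mf (A : set R) : measurable_fun A (EFin \o (fun x : R => x `^ (t - 1))).
  apply/measurable_EFinP; by apply: measurable_funTS; exact: measurable_powR.
(* Starting at [n.+2] keeps the left endpoint strictly below 1 from [n = 0] on, as the fundamental
   theorem requires. *)
pose F n : set R := [set` `[n.+2%:R^-1, 1]].
have FI n : (\int[lebesgue_measure]_(x in F n) (x `^ (t - 1))%:E =
    (t^-1 - (n.+2%:R^-1 : R) `^ t / t)%:E)%E.
  have n0 : 0 < n.+2%:R^-1 :> R by rewrite invr_gt0.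
  have pos (x : R) : n.+2%:R^-1 <= x -> 0 < x by exact: lt_le_trans.
  have D (x : R) : 0 < x -> 
      is_derive x 1 (fun y : R => y `^ t / t) (x `^ (t - 1)).
    move=> x0; have H := is_derive1_powR t x0.
    rewrite [X in is_derive _ _ X](_ : _ = t^-1 \*: (@powR R ^~ t)); last first.
      by apply/funext => y /=; rewrite mulrC.
    apply: is_derive_eq; by rewrite /GRing.scale/= mulKf// gt_eqF.
  have C (x : R) : 0 < x -> {for x, continuous (fun y : R => y `^ t / t)}.
    move=> x0; apply: differentiable_continuous; apply/derivable1_diffP.
    exact: (@ex_derive _ _ _ _ _ _ _ (D _ x0)).
  rewrite /F (@continuous_FTC2 _ _ (fun y => y `^ t / t)).
  - by rewrite powR1 mul1r EFinB.
  - by rewrite invf_lt1// ltr1n.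
  - apply: continuous_in_subspaceT => x /[!inE]/= /[!in_itv]/= /andP[/pos x0 _].
    apply: differentiable_continuous; apply/derivable1_diffP.
    by apply: derivable_powR; rewrite in_itv/= andbT.
  - split.
    + move=> x /[!in_itv]/= /andP[/ltW/pos x0 _].
      exact: (@ex_derive _ _ _ _ _ _ _ (D _ x0)).
    + apply: cvg_at_right_filter; exact: C.
    + apply: cvg_at_left_filter; exact: C.
  - move=> x /[!in_itv]/= /andP[/ltW/pos x0 _].
    by rewrite derive1E (@derive_val _ _ _ _ _ _ _ (D _ x0)).
have FU : \bigcup_n F n = [set` `]0, 1]].
  apply/seteqP; split => x /=.
    move=> [n _]; rewrite /F/= !in_itv/= => /andP[h ->]; rewrite andbT.
    by apply: lt_le_trans h; rewrite invr_gt0.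
  (* With [m] the integer part of [x^-1], one has [x^-1 < m + 1 <= m + 2], so [x] lies in [F m]. *)
  rewrite in_itv/= => /andP[x0 x1]; exists (Num.truncn x^-1) => //.
  rewrite /F/= in_itv/= x1 andbT -[leRHS]invrK lef_pV2 ?posrE ?invr_gt0//.
  by rewrite (le_trans (ltW (truncnS_gt x^-1)))// ler_nat.
(* The union of the [F n] contains the endpoint 1, which is added to the domain at no cost to the
   integral. *)
rewrite -(integral_itv_bndoo false false); last exact: mf.
have lim_int : (\int[lebesgue_measure]_(x in F n) (x `^ (t - 1))%:E)%E
    @[n --> \oo] -->
    (\int[lebesgue_measure]_(x in \bigcup_n F n) (x `^ (t - 1))%:E)%E.
  apply: ge0_nondecreasing_set_cvg_integral.
  - move=> n m nm; apply/subsetPset => x; rewrite /F/= !in_itv/= => /andP[h ->].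
    by rewrite andbT (le_trans _ h)// lef_pV2 ?posrE// ler_nat.
  - by move=> n; exact: measurable_itv.
  - by move=> n; exact: mf.
  - by move=> n x _; rewrite lee_fin powR_ge0.
have lim_val : (\int[lebesgue_measure]_(x in F n) (x `^ (t - 1))%:E)%E
    @[n --> \oo] --> (t^-1)%:E.
  under eq_fun do rewrite FI.
  apply: cvg_EFin; first by near=> n.
  rewrite -[X in _ --> X]subr0; apply: cvgB; first exact: cvg_cst.
  rewrite -[X in _ --> X](mul0r t^-1); apply: cvgMl.
  have /cvg_at_rightP := powR_cvg0 t0; apply; split=> [n|].
    by rewrite invr_gt0.
  by have := @cvg_harmonic R; rewrite -cvg_shiftS.
by rewrite -FU; apply: (cvg_unique _ lim_int lim_val); exact: ereal_hausdorff.
Unshelve. all: by end_near. Qed.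

(** * Integrals of product functions over the unit cube *)

(** Induction on [k], splitting off the first coordinate. Nonnegativity lets Tonelli apply without
    integrability, so infinite factors are allowed. *)
Lemma integral_tuple_prod (R : realType) (k : nat)
    (h : 'I_k -> measurableTypeR R -> R) :
  (forall i, measurable_fun setT (h i)) -> (forall i x, 0 <= h i x) ->
  (\int[lebesgue_measure_tuple R k]_x (\prod_(i < k) h i (tnth x i))%:E =
   \prod_(i < k) \int[lebesgue_measure]_x (h i x)%:E)%E.
Proof.
elim: k h => [|k IH] h mh h0.
  rewrite big_ord0 /= integral_dirac//=; first by rewrite diracT mul1e big_ord0.
  by under eq_fun do rewrite big_ord0; exact: measurable_cst.
have m_prod (n : nat) (g : 'I_n -> measurableTypeR R -> R) :
    (forall i, measurable_fun setT (g i)) ->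
    measurable_fun setT (fun x : n.-tuple (measurableTypeR R) =>
      \prod_(i < n) g i (tnth x i)).
  move=> mg; apply: measurable_prod => i _.
  by apply: measurableT_comp => //; exact: measurable_tnth.
(* The measure in dimension [k.+1] unfolds to this pushforward, which exposes the change of
   variables along [tuple_cons]. *)
transitivity (\int[pushforward
    (lebesgue_measure \x lebesgue_measure_tuple R k)%E
    (@tuple_cons _ (measurableTypeR R) k)]_x
    (\prod_(i < k.+1) h i (tnth x i))%:E)%E => //.
rewrite ge0_integral_pushforward//; [|exact: measurable_tuple_cons| |]; last 2 first.
- by apply/measurable_EFinP; exact: m_prod.
- by move=> x _; rewrite lee_fin prodr_ge0.
rewrite preimage_setT fubini_tonelli1; last 2 first.
- apply/measurable_EFinP; apply: (measurableT_comp (m_prod _ _ mh)).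
  exact: measurable_tuple_cons.
- by move=> x; rewrite lee_fin prodr_ge0.
have tailE : (\int[lebesgue_measure_tuple R k]_y
    (\prod_(i < k) h (lift ord0 i) (tnth y i))%:E =
    \prod_(i < k) \int[lebesgue_measure]_x (h (lift ord0 i) x)%:E)%E.
  exact: IH.
(* The tail integral is a constant for the outer variable, and [h ord0 t] a constant for the inner
   one; moving both inside turns the product of integrals into the iterated integral. *)
rewrite big_ord_recl muleC -tailE -ge0_integralZl//=; last 3 first.
- by apply/measurable_EFinP.
- by move=> x _; rewrite lee_fin.
- by apply: integral_ge0 => y _; rewrite lee_fin prodr_ge0.
apply: eq_integral => t _; rewrite /fubini_F/= muleC.
rewrite -ge0_integralZl//=; last 3 first.
- by apply/measurable_EFinP; exact: (m_prod _ (fun i => h (lift ord0 i))).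
- by move=> y _; rewrite lee_fin prodr_ge0.
- by rewrite lee_fin.
apply: eq_integral => y _; rewrite -EFinM big_ord_recl; congr (_ * _)%:E.
by apply: eq_bigr => i _; rewrite tnthS.
Qed.

Lemma measurable_open_cube (R : realType) (k : nat) :
  measurable (@open_cube R k).
Proof.
rewrite (_ : @open_cube R k = \bigcap_(i in [set: 'I_k])
    ((fun x : k.-tuple (measurableTypeR R) => tnth x i) @^-1` [set` `]0, 1[])).
  apply: fin_bigcap_measurable => // i _.
  by rewrite -[X in measurable X]setTI; exact: measurable_tnth.
by apply/seteqP; split => x /= H i; have := H i; rewrite /= in_itv//= => ->.
Qed.

Lemma measurable_coord_prod (R : realType) (k : nat) :
  measurable_fun setT (@coord_prod R k).
Proof. by apply: measurable_prod => i _; exact: measurable_tnth. Qed.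

(** The first coordinate alone gives the strict upper bound, since the others contribute a factor at
    most 1. In dimension 0 the empty product would be 1. *)
Lemma coord_prod_itv (R : realType) (k : nat)
    (x : k.-tuple (measurableTypeR R)) :
  (0 < k)%N -> open_cube x -> 0 < coord_prod x < 1.
Proof.
case: k x => // k x _ Hx.
have pos n (y : n.-tuple (measurableTypeR R)) :
    open_cube y -> 0 < coord_prod y <= 1.
  move=> Hy; rewrite prodr_gt0 => [|i _]; last by have /andP[] := Hy i.
  by apply: Num.Theory.prodr_ile1 => i _; have /andP[/ltW -> /ltW ->] := Hy i.
have /andP[-> _] := pos _ _ Hx.
rewrite /coord_prod big_ord_recl; have /andP[x0 x1] := Hx ord0.
apply: le_lt_trans x1; rewrite ler_piMr ?(ltW x0)//.
apply: Num.Theory.prodr_ile1 => i _.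
by have /andP[/ltW -> /ltW ->] := Hx (lift ord0 i).
Qed.

Lemma powR_prod (R : realType) (I : Type) (r : seq I) (F : I -> R) (c : R) :
  (forall i, 0 <= F i) ->
  (\prod_(i <- r) F i) `^ c = \prod_(i <- r) F i `^ c.
Proof.
move=> F0; elim: r => [|i r IH]; first by rewrite !big_nil powR1.
by rewrite !big_cons powRM ?prodr_ge0// IH.
Qed.

(** The indicator of the cube is the product of the indicators of []0, 1[] in each coordinate, so
    the integral is the [k]-th power of the one-dimensional one. *)
Lemma integral_cube_powR (R : realType) (k : nat) (t : R) : 0 < t ->
  (\int[lebesgue_measure_tuple R k]_(x in @open_cube R k)
     (coord_prod x `^ (t - 1))%:E = (t ^- k)%:E)%E.
Proof.
move=> t0.
pose h : measurableTypeR R -> R := (@powR R ^~ (t - 1)) \_ [set` `]0, 1[].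
have h0 y : 0 <= h y by rewrite /h patchE; case: ifP => // _; exact: powR_ge0.
rewrite integral_mkcond.
transitivity (\int[lebesgue_measure_tuple R k]_x
    (\prod_(i < k) h (tnth x i))%:E)%E.
  apply: eq_integral => x _; rewrite patchE; case: ifPn => [|/negP].
    rewrite inE => Hx; congr EFin.
    have pos (i : 'I_k) : 0 <= (tnth x i : R) by have /andP[/ltW] := Hx i.
    rewrite /coord_prod powR_prod//; apply: eq_bigr => i _.
    by rewrite /h patchE mem_set//= in_itv/=; exact: Hx.
  (* Off the cube some coordinate leaves []0, 1[], and its zero factor kills the product. *)
  rewrite inE => /existsNP[i /negP xi]; congr EFin.
  rewrite (bigD1 i)//= /h patchE memNset ?mul0r//= in_itv/=; exact/negP.
rewrite (@integral_tuple_prod _ _ (fun=> h))//; last first.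
  move=> _; apply/(measurable_restrictT (@powR R ^~ (t - 1))
    (measurable_itv `]0, 1[)).
  by apply: measurable_funTS; exact: measurable_powR.
have -> : (\int[lebesgue_measure]_y (h y)%:E = (t^-1)%:E)%E.
  by rewrite -integral_oo01_powR// [RHS]integral_mkcond restrict_EFin.
by rewrite prodEFin prodr_const card_ord exprVn.
Qed.

(** * Convergence of the series for exponents at least 2 *)

(** Comparison with a telescoping series, whose terms decay like [n^-2]. *)
Lemma cvg_series_addr_exprV (R : realType) (k : nat) (t : R) : 0 < t ->
  (1 < k)%N -> cvgn (series (fun n : nat => (n%:R + t) ^- k)).
Proof.
case: k => [//|[//|k]] t0 _.
have nt0 n : 0 < n%:R + t by rewrite ltr_wpDl.
(* The minus sign makes [v] increasing and bounded above by 0, hence convergent, with positive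
   differences. *)
pose v (n : nat) : R := - (n%:R + t)^-1.
have vE n : telescope v n = ((n%:R + t) * (n.+1%:R + t))^-1.
  rewrite /telescope/= /v opprK; have := nt0 n; have := nt0 n.+1.
  rewrite -natr1 => H1 H2; field; by rewrite !gt_eqF.
have cv : cvgn v.
  apply: nondecreasing_is_cvgn.
    by move=> m n mn; rewrite lerN2 lef_pV2 ?posrE// lerD2r ler_nat.
  by exists 0 => _ [n _ <-]; rewrite oppr_le0 invr_ge0 ltW.
pose C : R := (1 + t^-1) / t ^+ k.
have C0 : 0 <= C by rewrite divr_ge0 ?addr_ge0 ?exprn_ge0 ?invr_ge0 ?ltW.
(* (n+t)^-(k+2) <= C / ((n+t) (n+1+t)), because n+1+t <= (1 + 1/t) (n+t) and
   t^k <= (n+t)^k. *)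
apply: (@series_le_cvg _ _ (C *: telescope v)).
- by move=> n; rewrite invr_ge0 exprn_ge0// ltW.
- by move=> n; rewrite /GRing.scale/= vE mulr_ge0// invr_ge0 mulr_ge0 ?ltW.
- move=> n; rewrite /GRing.scale/= vE.
  rewrite ler_pdivlMr ?mulr_gt0// mulrC ler_pdivrMr ?exprn_gt0//.
  rewrite exprS mulrCA ler_pM2l// exprS.
  have h1 : t ^+ k <= (n%:R + t) ^+ k.
    by apply: lerXn2r; rewrite ?nnegrE ?(ltW t0) ?(ltW (nt0 n)) ?lerDr.
  have h2 : n.+1%:R + t <= (1 + t^-1) * (n%:R + t).
    rewrite -subr_ge0 (_ : _ - _ = n%:R / t).
      by rewrite divr_ge0 ?(ltW t0).
    by rewrite -natr1; field; rewrite gt_eqF.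
  have -> : C * ((n%:R + t) * (n%:R + t) ^+ k) =
      (1 + t^-1) * (n%:R + t) * ((n%:R + t) ^+ k / t ^+ k).
    by rewrite /C; ring.
  apply: (le_trans h2); rewrite ler_peMr ?mulr_ge0 ?addr_ge0 ?invr_ge0
    ?(ltW t0) ?(ltW (nt0 n))//.
  by rewrite ler_pdivlMr ?mul1r// exprn_gt0.
- apply: is_cvg_seriesZ.
  rewrite telescopeK; apply: is_cvgB => //; exact: is_cvg_cst.
Qed.

(** * Monomials and the geometric kernel on the cube *)

(** On the cube the product is positive, so the two powers merge into one with [n + t] in place of
    [t]. *)
Lemma integral_cube_powRX (R : realType) (k n : nat) (t : R) :
  (0 < k)%N -> 0 < t ->
  (\int[lebesgue_measure_tuple R k]_(x in @open_cube R k)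
     (coord_prod x `^ (t - 1) * coord_prod x ^+ n)%:E = ((n%:R + t) ^- k)%:E)%E.
Proof.
move=> k0 t0; rewrite -integral_cube_powR; last by rewrite ltr_wpDl.
apply: eq_integral => x; rewrite inE => /(coord_prod_itv _ _ _ k0)/andP[p0 _].
rewrite -powR_mulrn ?ltW// -powRD; last by apply/implyP => _; rewrite gt_eqF.
by rewrite addrC addrA.
Qed.

Lemma measurable_powR_coord_prod (R : realType) (k : nat) (c : R) D :
  measurable_fun D (fun x : k.-tuple (measurableTypeR R) => coord_prod x `^ c).
Proof.
apply: measurable_funTS; apply: (measurableT_comp (measurable_powR c)).
exact: measurable_coord_prod.
Qed.

Lemma measurable_powR_coord_prodX (R : realType) (k n : nat) (c : R) D :
  measurable_fun D (fun x : k.-tuple (measurableTypeR R) =>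
    coord_prod x `^ c * coord_prod x ^+ n).
Proof.
apply: measurable_funM; first exact: measurable_powR_coord_prod.
by apply/measurable_funTS/measurable_funX; exact: measurable_coord_prod.
Qed.

Lemma geometric_denom_gt0 (R : realType) (e p : R) :
  `|e| <= 1 -> 0 < p < 1 -> 0 < 1 - e * p.
Proof.
move=> e1 /andP[p0 p1]; rewrite subr_gt0 (le_lt_trans (ler_norm _))//.
by rewrite normrM (gtr0_norm p0) (le_lt_trans _ p1)// ler_piMl// ltW.
Qed.

Lemma measurable_powR_geometric (R : realType) (k : nat) (c e : R) :
  (0 < k)%N -> `|e| <= 1 ->
  measurable_fun (@open_cube R k) (fun x : k.-tuple (measurableTypeR R) =>
    coord_prod x `^ c / (1 - e * coord_prod x)).
Proof.
move=> k0 e1; apply: measurable_funM; first exact: measurable_powR_coord_prod.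
(* The reciprocal agrees with the real power of exponent -1 because the denominator is positive on
   the cube. *)
apply: (eq_measurable_fun (fun x : k.-tuple (measurableTypeR R) =>
    (1 - e * coord_prod x) `^ (- 1))).
  move=> x; rewrite inE => /(coord_prod_itv _ _ _ k0) p01.
  by rewrite powR_inv1// ltW// geometric_denom_gt0.
apply: measurable_funTS; apply: (measurableT_comp (measurable_powR _)).
apply: measurable_funB; first exact: measurable_cst.
by apply: measurable_funM; [exact: measurable_cst|exact: measurable_coord_prod].
Qed.

Lemma geometric_cvg_01 (R : realType) (c e p : R) : `|e| <= 1 -> 0 < p < 1 ->
  series (geometric c (e * p)) n @[n --> \oo] --> c / (1 - e * p).
Proof.
move=> e1 /andP[p0 p1]; apply: cvg_geometric_series.
by rewrite normrM (gtr0_norm p0) (le_lt_trans _ p1)// ler_piMl// ltW.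
Qed.

(** * Term-by-term integration of the geometric expansion *)

(** All terms are nonnegative, so sum and integral commute in the extended reals; convergence, known
    beforehand, makes the value a real limit. For [k = 1] both sides would diverge. *)
Lemma integral_cube_powR_geometric_even (R : realType) (k : nat) (t : R) :
  (1 < k)%N -> 0 < t ->
  cvgn (series (fun n : nat => (n%:R + t) ^- k)) /\
  (\int[lebesgue_measure_tuple R k]_(x in @open_cube R k)
     (coord_prod x `^ (t - 1) / (1 - coord_prod x))%:E =
   (limn (series (fun n : nat => (n%:R + t) ^- k)))%:E)%E.
Proof.
move=> k1 t0; have k0 : (0 < k)%N by exact: ltnW.
have cu := cvg_series_addr_exprV _ _ _ t0 k1; split=> //.
have m1 : `|1 : R| <= 1 by rewrite normr1.
transitivity (\int[lebesgue_measure_tuple R k]_(x in @open_cube R k)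
    \sum_(0 <= n <oo) (coord_prod x `^ (t - 1) * coord_prod x ^+ n)%:E)%E.
  apply: eq_integral => x; rewrite inE => /(coord_prod_itv _ _ _ k0) p01.
  have := geometric_cvg_01 _ (coord_prod x `^ (t - 1)) _ _ m1 p01.
  rewrite !mul1r => H; rewrite -(cvg_lim _ H)// -EFin_lim; last first.
    by apply/cvg_ex; eexists; exact: H.
  by congr (limn _); apply/funext => n /=; rewrite sumEFin.
rewrite integral_nneseries; last 3 first.
- exact: measurable_open_cube.
- by move=> n; apply/measurable_EFinP; exact: measurable_powR_coord_prodX.
- move=> n x /(coord_prod_itv _ _ _ k0)/andP[p0 _].
  by rewrite lee_fin mulr_ge0 ?powR_ge0 ?exprn_ge0 ?ltW.
rewrite -EFin_lim//; congr (limn _); apply/funext => n /=.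
by rewrite -sumEFin; apply: eq_bigr => i _; rewrite integral_cube_powRX.
Qed.

(** Convergence of the series is a conclusion here: its partial sums are the integrals of the
    geometric partial sums, which dominated convergence sends to a finite integral. *)
Lemma integral_cube_powR_geometric_odd (R : realType) (k : nat) (t : R) :
  (0 < k)%N -> 0 < t ->
  cvgn (series (fun n : nat => (-1) ^+ n / (n%:R + t) ^+ k)) /\
  (\int[lebesgue_measure_tuple R k]_(x in @open_cube R k)
     (coord_prod x `^ (t - 1) / (1 + coord_prod x))%:E =
   (limn (series (fun n : nat => (-1) ^+ n / (n%:R + t) ^+ k)))%:E)%E.
Proof.
move=> k0 t0.
pose mu := lebesgue_measure_tuple R k; pose D := @open_cube R k.
have mD : measurable D := measurable_open_cube R k.
have m1 : `|-1 : R| <= 1 by rewrite normrN1.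
pose c (x : k.-tuple (measurableTypeR R)) := coord_prod x `^ (t - 1).
have p01 x : D x -> 0 < coord_prod x < 1 := coord_prod_itv _ _ x k0.
have mX n : measurable_fun D (fun x => c x * coord_prod x ^+ n).
  exact: measurable_powR_coord_prodX.
have intX n : (\int[mu]_(x in D) (c x * coord_prod x ^+ n)%:E =
    ((n%:R + t) ^- k)%:E)%E by exact: integral_cube_powRX.
have iX n : mu.-integrable D (EFin \o (fun x => c x * coord_prod x ^+ n)).
  apply/integrableP; split; first exact/measurable_EFinP.
  under eq_integral => x.
    rewrite inE => /p01/andP[p0 _].
    rewrite gee0_abs; last by rewrite lee_fin mulr_ge0 ?powR_ge0 ?exprn_ge0 ?ltW.
    over.
  by rewrite intX ltry.
have iY n : mu.-integrable D (EFin \o (fun x => c x * (- coord_prod x) ^+ n)).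
  have := integrableZl mD ((-1) ^+ n) (iX n); apply: eq_integrable => // x _ /=.
  by rewrite -EFinM (exprNn (coord_prod x)) mulrCA.
pose S (n : nat) x := (series (geometric (c x) (- coord_prod x)) n)%:E.
have intS n : (\int[mu]_(x in D) S n x =
    (series (fun n : nat => (-1) ^+ n / (n%:R + t) ^+ k) n)%:E)%E.
  under eq_integral do rewrite /S /= -sumEFin.
  rewrite integral_sum//= -sumEFin; apply: eq_bigr => i _.
  under eq_integral do rewrite (exprNn (coord_prod _)) mulrCA EFinM.
  by rewrite (integralZl mD (iX i)) intX -EFinM.
have cvgS : (\int[mu]_(x in D) S n x)%E @[n --> \oo] -->
    (\int[mu]_(x in D) (c x / (1 + coord_prod x))%:E)%E.
  apply: (dominated_cvg mD (g := EFin \o (fun x => 2 * c x))).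
  - move=> n; apply/measurable_EFinP; apply: measurable_sum => i.
    by have /measurable_int/measurable_EFinP := iY i.
  - move=> x /p01 /(geometric_cvg_01 _ (c x) _ _ m1); rewrite mulN1r opprK.
    by move=> H; apply: cvg_EFin => //; near=> n.
  - by [].
  - have := integrableZl mD 2 (iX 0); apply: eq_integrable => // x _ /=.
    by rewrite expr0 mulr1 -EFinM.
  - move=> n x /p01/andP[p0 p1]; rewrite /S lee_fin.
    (* In the closed form [c x * (1 - (-p)^n) / (1 + p)] the numerator's second factor is at most
       [1 + p^n <= 2] in absolute value, and the denominator exceeds 1. *)
    rewrite geometric_seriesE ?lt_eqF ?(lt_trans _ (ltr01)) ?oppr_lt0//=.
    rewrite opprK normrM normrM (ger0_norm (powR_ge0 _ _)) -mulrA mulrC.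
    rewrite ler_wpM2r ?powR_ge0//.
    rewrite normfV ler_pdivrMr ?normr_gt0 ?gt_eqF ?addr_gt0//.
    rewrite (gtr0_norm (addr_gt0 ltr01 p0)).
    rewrite (le_trans (ler_normB _ _))// normr1 normrX normrN (gtr0_norm p0).
    have : coord_prod x ^+ n <= 1 by rewrite exprn_ile1 ?ltW.
    by lra.
(* Finiteness of the limit, from the majorant [c x], turns convergence in the extended reals into
   convergence of real partial sums. *)
have fin : (\int[mu]_(x in D) (c x / (1 + coord_prod x))%:E)%E \is a fin_num.
  apply: integrable_fin_num => //; apply: (le_integrable mD _ _ (iX 0)).
    apply/measurable_EFinP; have := measurable_powR_geometric _ _ (t - 1) _ k0 m1.
    by under eq_fun do rewrite mulN1r opprK.
  move=> x /p01/andP[p0 p1] /=; rewrite lee_fin expr0 mulr1 normrM ler_piMr//.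
  by rewrite normfV invf_le1 ?gtr0_norm ?addr_gt0// lerDl ltW.
have := cvgS; rewrite -(fineK fin); under eq_fun do rewrite intS.
move=> /fine_cvgP[_ H]; split; first by apply/cvg_ex; eexists; exact: H.
by congr EFin; apply/esym/cvg_lim.
Unshelve. all: by end_near. Qed.

Lemma integral_cube_powR_geometric (R : realType) (k : nat) (t : R) :
  (0 < k)%N -> 0 < t ->
  let u := fun n : nat => ((-1) ^+ k) ^+ n / (n%:R + t) ^+ k in
  cvgn (series u) /\
  (\int[lebesgue_measure_tuple R k]_(x in @open_cube R k)
     (coord_prod x `^ (t - 1) / (1 - (-1) ^+ k * coord_prod x))%:E =
   (limn (series u))%:E)%E.
Proof.
move=> k0 t0 /=; rewrite -signr_odd; case: (boolP (odd k)) => [_|ek].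
  have [cu <-] := integral_cube_powR_geometric_odd R k t k0 t0; split=> //.
  by apply: eq_integral => x _; rewrite expr1 mulN1r opprK.
(* A positive even [k] is at least 2, which keeps clear of the divergent case. *)
have k1 : (1 < k)%N by case: k k0 ek => [|[|]].
have -> : (fun n : nat => ((-1) ^+ false) ^+ n / (n%:R + t) ^+ k) =
    (fun n : nat => (n%:R + t) ^- k).
  by apply/funext => n; rewrite expr0 expr1n mul1r.
have [cu <-] := integral_cube_powR_geometric_even R k t k1 t0; split=> //.
by apply: eq_integral => x _; rewrite expr0 mul1r.
Qed.

(** * The two halves of the bilateral sum and the final identity *)

(** Factor [a n + 1 = a (n + 1/a)]. *)
Lemma S_term_nonneg (R : realType) (a k n : nat) : (0 < a)%N ->
  S_term R k a n%:Z =
  a%:R ^- k * (((-1) ^+ k) ^+ n / (n%:R + a%:R^-1) ^+ k).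
Proof.
move=> a0; have aN0 : a%:R != 0 :> R by rewrite pnatr_eq0 -lt0n.
rewrite /S_term -PoszM -exprnP mulnC exprM mulrCA -invfM -exprMn.
congr (_ / _ ^+ k).
by rewrite intrD intrM -!pmulrn mulrDr divff.
Qed.

(** Here [- a (n + 1) + 1 = - a (n + (1 - 1/a))]; the sign [(-1)^k] from the denominator cancels one
    of the [n + 1] factors [(-1)^k] in the numerator. *)
Lemma S_term_neg (R : realType) (a k n : nat) : (0 < a)%N ->
  S_term R k a (- n.+1%:Z) =
  a%:R ^- k * (((-1) ^+ k) ^+ n / (n%:R + (1 - a%:R^-1)) ^+ k).
Proof.
move=> a0; have aN0 : a%:R != 0 :> R by rewrite pnatr_eq0 -lt0n.
rewrite /S_term mulNr -PoszM -exprnN invr_sign mulnC exprM.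
rewrite (_ : (_ + 1)%:~R = - (a%:R * (n%:R + (1 - a%:R^-1))) :> R); last first.
  rewrite intrD intrM mulrNz -!pmulrn -natr1.
  by field.
rewrite (exprNn (_ * _)) (exprMn _ a%:R) !invfM exprS mulrACA divff ?signr_eq0//.
by rewrite mul1r mulrCA.
Qed.

Theorem theorem2p1p1 (R : realType) (a k : nat)
    (ha : (2 <= a)%N) (hk : (1 <= k)%N) :
  cvg_sumZ (@S_term R k a) /\
  (((a%:R ^+ k)^-1 : R)%:E *
     \int[lebesgue_measure_tuple R k]_(x in @open_cube R k)
       (integrand a x)%:E)%E = (@bilateral_S R k a)%:E.
Proof.
have a0 : (0 < a)%N by exact: ltnW.
have t1 : 0 < a%:R^-1 :> R by rewrite invr_gt0 ltr0n.
(* This is where [2 <= a] matters: for [a = 1] the term at index -1 would have denominator 0. *)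
have t2 : 0 < 1 - a%:R^-1 :> R by rewrite subr_gt0 invf_lt1 ?ltr0n// ltr1n.
have [c1 i1] := integral_cube_powR_geometric R k _ hk t1.
have [c2 i2] := integral_cube_powR_geometric R k _ hk t2.
set u1 := (fun n : nat => _ / (n%:R + a%:R^-1) ^+ k) in c1 i1.
set u2 := (fun n : nat => _ / (n%:R + (1 - a%:R^-1)) ^+ k) in c2 i2.
rewrite /bilateral_S /cvg_sumZ /sumZ.
have -> : (fun n : nat => S_term R k a n%:Z) = a%:R ^- k *: u1.
  by apply/funext => n; rewrite S_term_nonneg.
have -> : (fun n : nat => S_term R k a (- n.+1%:Z)) = a%:R ^- k *: u2.
  by apply/funext => n; rewrite S_term_neg.
split; first by split; exact: is_cvg_seriesZ.
rewrite !lim_seriesZ// -scalerDr EFinM EFinD -i1 -i2.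
have e1 : `|(-1) ^+ k : R| <= 1 by rewrite normr_sign.
(* The two kernels are nonnegative and share their denominator; their exponents [t - 1] are
   [-1 + 1/a] and [-1/a], so their sum is [integrand]. *)
rewrite -ge0_integralD//.
- congr (_ * _)%E; apply: eq_integral => x _.
  rewrite -EFinD -mulrDl /integrand (addrC (- 1)).
  by rewrite (_ : 1 - a%:R^-1 - 1 = - a%:R^-1 :> R)// addrAC subrr add0r.
- exact: measurable_open_cube.
- move=> x /(coord_prod_itv _ _ _ hk) p01.
  by rewrite lee_fin divr_ge0 ?powR_ge0// ltW// geometric_denom_gt0.
- by apply/measurable_EFinP; exact: measurable_powR_geometric.
- move=> x /(coord_prod_itv _ _ _ hk) p01.
  by rewrite lee_fin divr_ge0 ?powR_ge0// ltW// geometric_denom_gt0.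
- by apply/measurable_EFinP; exact: measurable_powR_geometric.
Qed.
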